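(* Consider the single linear chance constrained program under an elliptical distribution $\tilde\xi\sim\mathbb P_{\mathrm E}(\mu,\Sigma,\hat g)$, $$v^*=\min_{x\in\mathcal X}\Big\{c^\top x:\ b_1(x)-\mu^\top a_1(x)\ge\Phi^{-1}(1-\varepsilon)\sqrt{a_1(x)^\top\Sigma a_1(x)}\Big\},$$ with $\varepsilon\in(0,1)$. ALSO-X provides an optimal solution to this program (in particular $v^A=v^*$), provided that (i) $\mathcal X\subseteq\{x:\sqrt{a_1(x)^\top\Sigma a_1(x)}=C\}$, where $C$ is a positive constant; or (ii) $\mathcal X\subseteq\{x: b_1(x)-\mu^\top a_1(x)=C\}$, where $C$ is an arbitrary constant.
   Context: Setting. $c\in\mathbb R^n$; $\mathcal X\subseteq\mathbb R^n$ is nonempty and closed (under (i) it need not be convex); $a_1:\mathbb R^n\to\mathbb R^m$ and $b_1:\mathbb R^n\to\mathbb R$ are affine. The chance constraint is $\mathbb P\{\tilde\xi^\top a_1(x)-b_1(x)\le0\}\ge1-\varepsilon$, and the program is assumed to have an optimal solution. Elliptical distributions. $\mathbb P_{\mathrm E}(\mu,\Sigma,\hat g)$ with location $\mu\in\mathbb R^m$, positive definite $\Sigma$ and generating function $\hat g$ has density proportional to $\hat g(\tfrac12(\cdot-\mu)^\top\Sigma^{-1}(\cdot-\mu))$. The standard univariate elliptical distribution $\mathbb P_{\mathrm E}(0,1,\hat g)$ has density $\varphi(z)=k\hat g(z^2/2)$ ($k>0$ normalizing) and cumulative distribution function $\Phi$; as usual, $(\tilde\xi^\top a-\mu^\top a)/\sqrt{a^\top\Sigma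 a}$ is taken to have this standard univariate distribution for every $a\neq0$. Let $G(\tau)=k\int_0^\tau\hat g(z)\,dz$ and $\overline G(\tau)=G(\infty)-G(\tau)$, with $G(\infty)<\infty$. ALSO-X in this setting: $$v^A=\min_t\ t\quad\text{s.t.}\quad b_1(x^* )-\mu^\top a_1(x^* )\ge\Phi^{-1}(1-\varepsilon)\sqrt{a_1(x^* )^\top\Sigma a_1(x^* )},$$ where $$(x^*,\alpha^* )\in\operatorname*{argmin}_{x\in\mathcal X,\alpha}\Big\{\sqrt{a_1(x)^\top\Sigma a_1(x)}\,\big(\overline G(\alpha^2/2)-\alpha+\alpha\Phi(\alpha)\big):\ c^\top x\le t,\ \tfrac{b_1(x)-\mu^\top a_1(x)}{\sqrt{a_1(x)^\top\Sigma a_1(x)}}=\alpha\Big\},$$ with $0/0=0$ and $r/0=\mathrm{sign}(r)\infty$ for $r\neq0$. The lower-level problem is the hinge-loss problem $\min_{x\in\mathcal X}\{\mathbb E[(\tilde\xi^\top a_1(x)-b_1(x))_+]:c^\top x\le t\}$, whose optimum is taken to be attained whenever its feasible set is nonempty.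
   Formalization: In case (ii) the formal theorem additionally assumes C ≥ 0 or Φ^{-1}(1-ε) ≥ 0; for C < 0 and Φ^{-1}(1-ε) < 0 the claim fails (e.g. ξ uniform on [-1,1], ε=0.6, a1(x)=x, b1=-1, c=1, X=[1,10]). *)

(* Defs.v *)
From HB Require Import structures.
From mathcomp Require Export all_boot all_order all_algebra.
From mathcomp Require Export all_classical all_reals all_analysis.
Export Order.TTheory GRing.Theory Num.Theory.
Export numFieldNormedType.Exports.

Set Implicit Arguments.
Unset Strict Implicit.
Unset Printing Implicit Defensive.

Global Open Scope classical_set_scope.
Global Open Scope ring_scope.

Definition minimizes (d : Order.disp_t) (D : porderType d) (T : Type)
    (F : set T) (f : T -> D) (x : T) : Prop :=
  F x /\ forall y, F y -> (f x <= f y)%O.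

Definition is_minimum (R : realType) (A : set R) (v : R) : Prop :=
  minimizes A id v.

Definition dotv (R : realType) (n : nat) (u v : 'cV[R]_n) : R :=
  (u^T *m v) 0 0.

Definition is_affine_vec (R : realType) (n m : nat)
    (a : 'cV[R]_n -> 'cV[R]_m) : Prop :=
  exists (A : 'M[R]_(m, n)) (a0 : 'cV[R]_m), forall x, a x = A *m x + a0.

Definition is_affine_fun (R : realType) (n : nat) (b : 'cV[R]_n -> R) : Prop :=
  exists (beta : 'cV[R]_n) (b0 : R), forall x, b x = dotv beta x + b0.

Definition posdef (R : realType) (m : nat) (S : 'M[R]_m) : Prop :=
  S^T = S /\ forall v : 'cV[R]_m, v != 0 -> 0 < dotv v (S *m v).

Definition sdev (R : realType) (m : nat) (S : 'M[R]_m) (a : 'cV[R]_m) : R :=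
  Num.sqrt (dotv a (S *m a)).

(* r / s with the conventions 0 / 0 = 0 and r / 0 = sign(r) oo;
   in \bar R one has 0 * +oo = 0. *)
Definition ratio (R : realType) (r s : R) : \bar R :=
  if s == 0 then ((Num.sg r)%:E * +oo)%E else (r / s)%:E.

Section StandardUnivariate.
Context {R : realType}.
Implicit Types (k : R) (ghat : R -> R).

Definition dens k ghat (z : R) : R := k * ghat (z ^+ 2 / 2).

(* k normalizes the density; the last clause is G(oo) < oo. *)
Definition std_elliptical k ghat : Prop :=
  [/\ 0 < k,
      forall z, 0 <= z -> 0 <= ghat z,
      measurable_fun (`[0, +oo[ : set R) ghat,
      (\int[lebesgue_measure]_z (dens k ghat z)%:E = 1)%E &
      (\int[lebesgue_measure]_(z in `[0%R, +oo[) (ghat z)%:E < +oo)%E].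

Definition Phi k ghat (z : R) : R :=
  fine (\int[lebesgue_measure]_(y in `]-oo, z]) (dens k ghat y)%:E)%E.

Definition Phi_inv k ghat (p : R) : R := inf [set z | p <= Phi k ghat z].

Definition G k ghat (tau : R) : R :=
  k * fine (\int[lebesgue_measure]_(z in `[0%R, tau]) (ghat z)%:E)%E.

Definition Ginfty k ghat : R :=
  k * fine (\int[lebesgue_measure]_(z in `[0%R, +oo[) (ghat z)%:E)%E.

Definition Gbar k ghat (tau : R) : R := Ginfty k ghat - G k ghat tau.

End StandardUnivariate.

(* Integral of a function over R^m with respect to Lebesgue measure, as an
   iterated integral (Tonelli); only used for nonnegative functions. *)
Fixpoint lebesgue_integral_vec (R : realType) (m : nat) :
    ('cV[R]_m -> \bar R) -> \bar R :=
  match m return ('cV[R]_m -> \bar R) -> \bar R with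
  | 0 => fun f => f 0
  | m'.+1 => fun f =>
      (\int[lebesgue_measure]_y
         lebesgue_integral_vec
           (fun z : 'cV[R]_m' => f (col_mx (y%:M : 'cV[R]_1) z)))%E
  end.

Section Elliptical.
Context {d : measure_display} {T : measurableType d} {R : realType}.
Variables (P : probability T R) (m : nat) (xi : 'I_m -> {RV P >-> R}).

Definition rvec (w : T) : 'cV[R]_m := \col_i xi i w.

(* The joint density is given through the joint distribution function. *)
Definition has_elliptical_density (mu : 'cV[R]_m) (S : 'M[R]_m)
    (g : R -> R) : Prop :=
  exists kappa : R,
  [/\ 0 < kappa,
      forall z, 0 <= z -> 0 <= g z,
      measurable_fun (`[0, +oo[ : set R) g &
      forall t : 'cV[R]_m,
        P [set w | forall i, rvec w i 0 <= t i 0] =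
        lebesgue_integral_vec (fun x =>
          (if [forall i, x i 0 <= t i 0] then
             kappa * g (dotv (x - mu) (invmx S *m (x - mu)) / 2)
           else 0)%:E)].

(* All standardized linear functionals have the univariate density
   k * ghat (z ^+ 2 / 2).  For m >= 2 the one-dimensional marginals of an
   elliptical density generally have another generator than the joint density,
   so the joint generator g is not required to be ghat (although g = ghat is
   allowed, and is forced up to a factor for m = 1). *)
Definition elliptical (mu : 'cV[R]_m) (S : 'M[R]_m) (k : R) (ghat : R -> R) :
    Prop :=
  (exists g : R -> R, has_elliptical_density mu S g) /\
  forall a : 'cV[R]_m, a != 0 ->
  forall B : set R, measurable B ->
    P [set w | B ((dotv (rvec w) a - dotv mu a) / sdev S a)] =
    (\int[lebesgue_measure]_(z in B) (dens k ghat z)%:E)%E.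

Variables (n : nat) (a1 : 'cV[R]_n -> 'cV[R]_m) (b1 : 'cV[R]_n -> R).

Definition chance_constraint (eps : R) (x : 'cV[R]_n) : Prop :=
  ((1 - eps)%:E <= P [set w | dotv (rvec w) (a1 x) - b1 x <= 0]%R)%E.

Definition expected_hinge (x : 'cV[R]_n) : \bar R :=
  'E_P[fun w => Num.max (dotv (rvec w) (a1 x) - b1 x)%R 0%R].

End Elliptical.

Section AlsoX.
Context {R : realType}.
Variables (n m : nat) (c : 'cV[R]_n) (X : set 'cV[R]_n).
Variables (a1 : 'cV[R]_n -> 'cV[R]_m) (b1 : 'cV[R]_n -> R).
Variables (mu : 'cV[R]_m) (S : 'M[R]_m) (k : R) (ghat : R -> R) (eps : R).

Definition margin (x : 'cV[R]_n) : R := b1 x - dotv mu (a1 x).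

Definition quantile_constraint (x : 'cV[R]_n) : Prop :=
  margin x >= Phi_inv k ghat (1 - eps) * sdev S (a1 x).

Definition level_set (t : R) : set 'cV[R]_n := [set x | X x /\ dotv c x <= t].

Definition lower_level_feasible (t : R) : set ('cV[R]_n * \bar R) :=
  [set p | level_set t p.1 /\ ratio (margin p.1) (sdev S (a1 p.1)) = p.2].

(* The infinite values of alpha occur only when sdev S (a1 x) = 0; the
   resulting product of the form 0 * oo then takes the value of the hinge loss,
   i.e. the positive part of - margin x. *)
Definition lower_level_objective (p : 'cV[R]_n * \bar R) : R :=
  match p.2 with
  | EFin al => sdev S (a1 p.1) *
      (Gbar k ghat (al ^+ 2 / 2) - al + al * Phi k ghat al)
  | +oo%E => 0
  | -oo%E => - margin p.1
  end.

Definition lower_level_solution (t : R) (x : 'cV[R]_n) (al : \bar R) : Prop :=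
  minimizes (lower_level_feasible t) lower_level_objective (x, al).

Definition alsox_feasible : set R :=
  [set t | exists x al, lower_level_solution t x al /\ quantile_constraint x].

End AlsoX.

(* Main.v *)
(** By the substitution u = z^2/2, the lower-level objective at margin M and
    deviation s is the expected hinge loss s h(M/s), where h(al) = E[(Z - al)_+]
    and Z has the standard univariate law.  The function h is nonnegative and
    nonincreasing, and h(be) < h(al) whenever al < q <= be for q the quantile of
    order 1 - eps, since Phi < 1 - eps below q.  A lower-level solution at
    t = vstar has an objective not above that of an optimal solution, whose
    ratio M/s is at least q.  If s is constant, its own ratio M/s is then at
    least q.  If M = C >= 0 is constant, a ratio C/s < q would give both a
    larger s and a larger h(C/s), hence a larger product; C < 0 <= q is
    infeasible. *)

Require Import Defs.
From HB Require Import structures.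
From mathcomp Require Import measurable_realfun ring lra.
Import HBNNSimple.

Set Implicit Arguments.
Unset Strict Implicit.
Unset Printing Implicit Defensive.

(** * Measures given by a density *)

Section DensityMeasure.
Local Open Scope ereal_scope.
Context {d : measure_display} {T : measurableType d} {R : realType}.
Variables (mu : {measure set T -> \bar R}) (w : T -> R).

(* The proof arguments let the measure instance be inferred from the term. *)
Definition mdensity of (forall x, 0 <= w x)%R & measurable_fun [set: T] w :=
  fun A : set T => \int[mu]_(x in A) (w x)%:E.

Hypotheses (w_ge0 : forall x, (0 <= w x)%R) (mw : measurable_fun [set: T] w).

Local Notation nu := (mdensity w_ge0 mw).

Let w_ge0E x : 0 <= (w x)%:E.
Proof. by rewrite lee_fin. Qed.

Let mwE : measurable_fun [set: T] (EFin \o w).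
Proof. exact/measurable_EFinP. Qed.

Let mdensity0 : nu set0 = 0.
Proof. exact: integral_set0. Qed.

Let mdensity_ge0 A : 0 <= nu A.
Proof. by apply: integral_ge0 => x _; rewrite lee_fin. Qed.

Let mdensity_sigma_additive : semi_sigma_additive nu.
Proof.
move=> /= F mF tF mUF; rewrite /mdensity; apply: cvg_toP.
  apply: ereal_nondecreasing_is_cvgn => i j ij.
  by apply: lee_sum_nneg_natr => // l _ _; exact: mdensity_ge0.
rewrite ge0_integral_bigcup//=; first exact: measurable_funTS.
Qed.

HB.instance Definition _ := isMeasure.Build _ _ _
  nu mdensity0 mdensity_ge0 mdensity_sigma_additive.

(** Monotone convergence on both sides reduces the identity to simple functions, and linearity
    reduces it to indicators of level sets, where it is the definition of [mdensity]. *)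
Lemma ge0_integral_mdensity (f : T -> \bar R) :
  measurable_fun [set: T] f -> (forall x, 0 <= f x) ->
  \int[nu]_x f x = \int[mu]_x (f x * (w x)%:E).
Proof.
move=> mf f0; pose f_ := nnsfun_approx measurableT mf.
transitivity (limn (fun n => \int[nu]_x (f_ n x)%:E)).
  rewrite -monotone_convergence//.
  - apply: eq_integral => x _; apply/esym/cvg_lim => //.
    exact: cvg_nnsfun_approx.
  - by move=> n; exact/measurable_EFinP/measurable_funP.
  - by move=> n y _; rewrite lee_fin.
  - by move=> y _ i j ij; rewrite lee_fin; exact/lefP/nd_nnsfun_approx.
transitivity (limn (fun n => \int[mu]_x ((f_ n x)%:E * (w x)%:E))); last first.
  rewrite -monotone_convergence//.
  - apply: eq_integral => x _; apply/cvg_lim => //.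
    by apply: cvgeZr => //; exact: cvg_nnsfun_approx.
  - move=> n; apply: emeasurable_funM => //; exact/measurable_EFinP.
  - by move=> n x _; rewrite mule_ge0 ?lee_fin.
  - move=> y _ i j ij; apply: lee_wpmul2r => //.
    by rewrite lee_fin; exact/lefP/nd_nnsfun_approx.
congr (limn _); apply/funext => n.
have mpre r : measurable (f_ n @^-1` [set r]) by exact: measurable_funPTI.
transitivity (\sum_(k \in range (f_ n))
    \int[mu]_x (k * \1_(f_ n @^-1` [set k]) x * w x)%:E).
  under eq_integral do rewrite fimfunE -fsumEFin//.
  rewrite ge0_integral_fsum//; last 2 first.
  - by move=> r; exact/measurable_EFinP/measurable_funM.
  - by move=> r x _; rewrite nnfun_muleindic_ge0.
  apply: eq_fsbigr => r /set_mem [x _ <-].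
  rewrite integralZl_indic_nnsfun// integral_indic// setIT.
  under [RHS]eq_integral do rewrite -mulrA EFinM.
  rewrite ge0_integralZl//; last 3 first.
  - by apply/measurable_EFinP; exact: measurable_funM.
  - by move=> y _; rewrite lee_fin mulr_ge0.
  - by rewrite lee_fin.
  congr (_ * _); rewrite /mdensity/= [LHS]integral_mkcond.
  apply: eq_integral => y _; rewrite patchE indicE.
  by case: ifPn => _; rewrite ?mul1r ?mul0r.
rewrite -ge0_integral_fsum//.
- apply: eq_integral => x _; rewrite fsumEFin// -mulr_fsuml//.
  by rewrite -fimfunE.
- by move=> r; apply/measurable_EFinP; do 2 apply: measurable_funM => //.
- move=> r x _; rewrite lee_fin mulr_ge0//.
  by have := nnfun_muleindic_ge0 (f_ n) r x; rewrite lee_fin.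
Qed.

End DensityMeasure.

(** * Change of variables by the signed half square *)

Section SignedHalfSquare.
Context {R : realType}.
Local Notation mu := (@lebesgue_measure R).

(* An increasing bijection of the whole line, unlike z^2/2, so that its image
   measure can be compared with Lebesgue measure on all intervals. *)
Definition signed_half_square (z : R) : R := z * `|z| / 2.
Local Notation sq := signed_half_square.

Lemma continuous_signed_half_square : continuous sq.
Proof.
move=> z; rewrite /sq; apply: cvgM; last exact: cvg_cst.
apply: cvgM; first exact: cvg_id.
exact: norm_continuous.
Qed.

Lemma signed_half_square_mono : {mono sq : x y / x <= y}.
Proof.
apply: le_mono => x y xy; rewrite /sq ltr_pM2r ?invr_gt0//.
have [x0|x0] := leP 0 x; have [y0|y0] := leP 0 y;
  rewrite ?(ger0_norm x0) ?(ltr0_norm x0) ?(ger0_norm y0) ?(ltr0_norm y0); nra.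
Qed.

Lemma signed_half_square_surj u : exists z, sq z = u.
Proof.
exists (Num.sg u * Num.sqrt (2 * `|u|)); rewrite /sq normrM normr_sg.
rewrite (ger0_norm (sqrtr_ge0 _)).
have -> : Num.sg u * Num.sqrt (2 * `|u|) *
    ((u != 0)%:R * Num.sqrt (2 * `|u|)) / 2 =
    Num.sg u * (u != 0)%:R * (Num.sqrt (2 * `|u|) ^+ 2) / 2.
  by field.
rewrite sqr_sqrtr ?mulr_ge0//.
have [->|u0] := eqVneq u 0; first by rewrite sgr0 !mul0r.
by rewrite mulr1 mulrCA mulrAC mulfV// mul1r -numEsg.
Qed.

(** The bound is uniform in [z], so it yields the derivative [|z|] at every point, including 0,
    where the two branches meet. *)
Lemma signed_half_square_taylor z h :
  `|sq (z + h) - sq z - `|z| * h| <= h ^+ 2 / 2.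
Proof.
rewrite /sq ler_norml expr2.
have [z0|z0] := leP 0 z; have [y0|y0] := leP 0 (z + h);
  rewrite ?(ger0_norm z0) ?(ltr0_norm z0) ?(ger0_norm y0) ?(ltr0_norm y0);
  apply/andP; split; nra.
Qed.

Lemma is_derive_signed_half_square (z : R) : is_derive z (1 : R) sq `|z|.
Proof.
have sq_cvg : h^-1 *: ((sq \o shift z) (h *: (1 : R)) - sq z)
    @[h --> 0^'] --> `|z|.
  apply/cvgrPdist_le => e e0; near=> h.
  have h0 : h != 0 by near: h; exact: nbhs_dnbhs_neq.
  have he : `|h| <= e.
    by near: h; apply: dnbhs0_le.
  have -> : `|z| - h^-1 *: ((sq \o shift z) (h *: (1 : R)) - sq z) =
      - (h^-1 * (sq (z + h) - sq z - `|z| * h)).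
    rewrite /= {1}/GRing.scale/= [h *: _]mulr1 [h + z]addrC.
    by field.
  rewrite normrN normrM normfV ler_pdivrMl ?normr_gt0//.
  apply: (le_trans (signed_half_square_taylor z h)).
  by rewrite -(real_normK (num_real h)) expr2; have := normr_ge0 h; nra.
apply: DeriveDef; first by apply/cvg_ex; exists `|z|.
exact: cvg_lim sq_cvg.
Unshelve. all: by end_near. Qed.

Lemma integral_norm_itv a b : a <= b ->
  (\int[mu]_(z in `]a, b]) `|z|%:E = (sq b - sq a)%:E)%E.
Proof.
rewrite le_eqVlt => /predU1P[->|ab].
  by rewrite set_itvoc0 integral_set0 subrr.
rewrite integral_itv_obnd_cbnd; last first.
  apply/measurable_EFinP/measurable_funTS.
  exact: continuous_measurable_fun norm_continuous.
rewrite (@continuous_FTC2 _ _ sq)//.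
- apply: continuous_subspaceT => x; exact: norm_continuous.
- split.
  + by move=> x _; apply: ex_derive; exact: is_derive_signed_half_square.
  + by apply/cvg_at_right_filter; exact: continuous_signed_half_square.
  + by apply/cvg_at_left_filter; exact: continuous_signed_half_square.
- move=> x _; rewrite derive1E.
  have H := is_derive_signed_half_square x.
  by rewrite derive_val.
Qed.

(** The image under [sq] of the measure with density [|z|] gives each interval []a, b]] its length,
    so by uniqueness it is Lebesgue measure. *)
Lemma ge0_integral_signed_half_square (f : R -> \bar R) :
  measurable_fun [set: R] f -> (forall x, 0 <= f x)%E ->
  (\int[mu]_u f u = \int[mu]_z (f (sq z) * `|z|%:E))%E.
Proof.
move=> mf f0.
have msq : measurable_fun [set: R] sq.
  exact: continuous_measurable_fun continuous_signed_half_square.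
have mnorm : measurable_fun [set: R] (fun z : R => `|z|).
  exact: continuous_measurable_fun norm_continuous.
have norm_ge0 : forall z : R, 0 <= `|z| by [].
pose nu := mdensity mu norm_ge0 mnorm.
rewrite -(ge0_integral_mdensity mu norm_ge0 mnorm)//; last first.
  exact: measurableT_comp.
transitivity (\int[pushforward nu (sq : R -> measurableTypeR R)]_u f u)%E;
    last by rewrite ge0_integral_pushforward.
apply: eq_measure_integral => A mA _.
rewrite -[RHS]/(pushforward nu (sq : R -> measurableTypeR R) A).
apply: lebesgue_measure_unique => //= _ [[a b]] /= _ <-.
rewrite lebesgue_measure_itv/= lte_fin /pushforward/=.
(* With both endpoints written as values of [sq], monotonicity makes the preimage an interval
   again. *)
have [a' <-] := signed_half_square_surj a.
have [b' <-] := signed_half_square_surj b.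
have -> : sq @^-1` `]sq a', sq b'] = `]a', b']%classic.
  apply/seteqP; split=> z /=; rewrite !in_itv/= signed_half_square_mono.
    by rewrite !ltNge signed_half_square_mono.
  by rewrite !ltNge signed_half_square_mono.
rewrite !ltNge signed_half_square_mono.
case: leP => [b'a'|/ltW a'b'].
  by rewrite set_itv_ge ?measure0// bnd_simp -leNgt.
by rewrite /nu/= /mdensity integral_norm_itv// EFinB.
Qed.

End SignedHalfSquare.

Lemma ge0_integral_lebesgueN (R : realType) (f : R -> \bar R) :
  measurable_fun [set: R] f -> (forall x, 0 <= f x)%E ->
  (\int[lebesgue_measure]_x f (- x)%R = \int[lebesgue_measure]_x f x)%E.
Proof.
move=> mf f0.
transitivity (\int[pushforward lebesgue_measure
    (-%R : R -> measurableTypeR R)]_x f x)%E.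
  by rewrite ge0_integral_pushforward.
by apply: eq_measure_integral => A mA _; exact: lebesgue_measureN.
Qed.

(** * The standard univariate law: distribution function, quantile, expected hinge loss *)

Section StandardElliptical.
Context {R : realType}.
Variables (k : R) (ghat : R -> R).
Hypothesis ghat_std : std_elliptical k ghat.
Local Notation mu := (@lebesgue_measure R).
Local Notation w := (dens k ghat).

Let k_gt0 : 0 < k. Proof. by case: ghat_std. Qed.
Let ghat_ge0 z : 0 <= z -> 0 <= ghat z.
Proof. by case: ghat_std => _ + _ _ _; exact. Qed.

Let half_sqr_ge0 (z : R) : 0 <= z ^+ 2 / 2.
Proof. by rewrite divr_ge0 ?sqr_ge0. Qed.

Lemma dens_ge0 z : 0 <= w z.
Proof. by rewrite mulr_ge0 ?ghat_ge0 ?half_sqr_ge0// ltW. Qed.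

Lemma densN z : w (- z) = w z.
Proof. by rewrite /dens sqrrN. Qed.

Let measurable_restr : measurable_fun [set: R] (ghat \_ `[0, +oo[).
Proof.
apply/(measurable_restrictT _ _).1 => //.
by case: ghat_std.
Qed.

(** [ghat] is only known to be measurable on the half-line. Its extension by zero is measurable
    everywhere and agrees with it at [z ^+ 2 / 2]. *)
Lemma measurable_dens : measurable_fun [set: R] w.
Proof.
rewrite (_ : w = fun z => k * (ghat \_ `[0, +oo[) (z ^+ 2 / 2)); last first.
  by apply/funext => z; rewrite patchE mem_set//= in_itv/= half_sqr_ge0.
apply: measurable_funM => //.
apply: (measurableT_comp measurable_restr).
by apply: measurable_funM => //; exact: measurable_funX.
Qed.

Let measurable_EFin_dens : measurable_fun [set: R] (EFin \o w).
Proof. by apply/measurable_EFinP; exact: measurable_dens. Qed.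

Let mdensM (f : R -> R) : measurable_fun [set: R] f ->
  measurable_fun [set: R] (fun z => (f z * w z)%:E).
Proof.
move=> mf; apply/measurable_EFinP.
by apply: measurable_funM => //; exact: measurable_dens.
Qed.

Lemma integral_dens : (\int[mu]_z (w z)%:E = 1)%E.
Proof. by case: ghat_std. Qed.

Lemma integral_dens_le1 (A : set R) : measurable A ->
  (\int[mu]_(z in A) (w z)%:E <= 1)%E.
Proof.
move=> mA; rewrite -integral_dens; apply: ge0_subset_integral => //.
by move=> z _; rewrite lee_fin dens_ge0.
Qed.

Lemma PhiE z : (\int[mu]_(y in `]-oo, z]) (w y)%:E = (Phi k ghat z)%:E)%E.
Proof.
rewrite /Phi fineK// ge0_fin_numE.
  by apply: le_lt_trans (ltry 1); exact: integral_dens_le1.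
by apply: integral_ge0 => y _; rewrite lee_fin dens_ge0.
Qed.

Lemma integral_dens_tail z :
  (\int[mu]_(y in `]z, +oo[) (w y)%:E = (1 - Phi k ghat z)%:E)%E.
Proof.
have : (\int[mu]_y (w y)%:E = \int[mu]_(y in `]-oo, z]) (w y)%:E +
    \int[mu]_(y in `]z, +oo[) (w y)%:E)%E.
  rewrite -setCitvl -ge0_integral_setU//.
  - by rewrite setUv.
  - exact: measurableC.
  - by rewrite setUv; exact: measurable_EFin_dens.
  - by move=> y _; rewrite lee_fin dens_ge0.
  - exact/disj_setPCl.
rewrite integral_dens PhiE.
move: (\int[mu]_(y in `]z, +oo[) (w y)%:E)%E => -[r| |]//= [h1].
by congr (_%:E); rewrite h1; ring.
Qed.

(** Reflection preserves the even density and maps []-oo, -z]] to [[z, +oo[], where the endpoint has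
    measure zero. *)
Lemma PhiN z : Phi k ghat (- z) = 1 - Phi k ghat z.
Proof.
apply: EFin_inj; rewrite -integral_dens_tail -PhiE.
rewrite integral_mkcond [RHS]integral_itv_obnd_cbnd; last first.
  exact: (measurable_funTS measurable_EFin_dens).
rewrite [RHS]integral_mkcond -ge0_integral_lebesgueN//.
- apply: eq_integral => x _; rewrite !patchE densN.
  by rewrite !mem_setE/= !in_itv/= andbT lerN2.
- apply/(measurable_restrictT _ _).1 => //.
  exact: (measurable_funTS measurable_EFin_dens).
- by apply: erestrict_ge0 => y _; rewrite lee_fin dens_ge0.
Qed.

Lemma integral_ghat_fin_num (A : set R) : measurable A -> A `<=` `[0, +oo[ ->
  (\int[mu]_(z in A) (ghat z)%:E)%E \is a fin_num.
Proof.
move=> mA A0; have [_ _ mg _ goo] := ghat_std.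
rewrite ge0_fin_numE; last first.
  apply: integral_ge0 => z /A0/=; rewrite in_itv/= andbT lee_fin.
  exact: ghat_ge0.
apply: le_lt_trans goo; apply: ge0_subset_integral => //.
  exact/measurable_EFinP.
by move=> z/=; rewrite in_itv/= andbT lee_fin; exact: ghat_ge0.
Qed.

Lemma GbarE tau : 0 <= tau ->
  (\int[mu]_(z in `]tau, +oo[) (k * ghat z)%:E = (Gbar k ghat tau)%:E)%E.
Proof.
move=> tau0; have [_ _ mg _ goo] := ghat_std.
have tauy : `]tau, +oo[ `<=` `[0, +oo[.
  by apply: subset_itvr; rewrite bnd_simp.
under eq_integral do rewrite EFinM.
rewrite ge0_integralZl//; last 3 first.
- by apply/measurable_EFinP; exact: measurable_funS mg.
- by move=> z /tauy/=; rewrite in_itv/= andbT lee_fin; exact: ghat_ge0.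
- by rewrite lee_fin ltW.
rewrite /Gbar /Ginfty /G -mulrBr EFinM; congr (_ * _)%E.
have -> : `[0%R, +oo[%classic = `[0%R, tau] `|` `]tau, +oo[ :> set R.
  by rewrite -itv_bndbnd_setU// bnd_simp.
have mgE : measurable_fun (`[0%R, +oo[ : set R) (EFin \o ghat).
  exact/measurable_EFinP.
have fin_l : (\int[mu]_(z in `[0%R, tau]) (ghat z)%:E)%E \is a fin_num.
  by apply: integral_ghat_fin_num => //; apply: subset_itvl; rewrite bnd_simp.
have fin_r : (\int[mu]_(z in `]tau, +oo[) (ghat z)%:E)%E \is a fin_num.
  exact: integral_ghat_fin_num.
rewrite ge0_integral_setU//.
- by rewrite fineD// addrAC subrr add0r fineK.
- by rewrite -itv_bndbnd_setU// bnd_simp.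
- rewrite -itv_bndbnd_setU// ?bnd_simp// => z /=.
  by rewrite in_itv/= andbT lee_fin; exact: ghat_ge0.
- rewrite disj_set2E; apply/eqP; rewrite -subset0 => z/=.
  by rewrite !in_itv/= andbT => -[/andP[_]]; rewrite leNgt => /negP.
Qed.

(** Substitute [u = z ^+ 2 / 2], [du = z dz]. For [al >= 0] the signed half square is the usual one
    on the tail, and its monotonicity excludes negative [z]. *)
Lemma integral_id_dens_tail al : 0 <= al ->
  (\int[mu]_(z in `]al, +oo[) (z * w z)%:E = (Gbar k ghat (al ^+ 2 / 2))%:E)%E.
Proof.
move=> al0; rewrite -GbarE//.
have [_ _ mg0 _ _] := ghat_std.
have aly : `]al ^+ 2 / 2, +oo[ `<=` `[0, +oo[.
  by apply: subset_itvr; rewrite bnd_simp.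
rewrite [LHS]integral_mkcond [RHS]integral_mkcond.
have mg : measurable_fun [set: R]
    ((fun z => (k * ghat z)%:E) \_ `]al ^+ 2 / 2, +oo[).
  apply/(measurable_restrictT _ _).1 => //; apply/measurable_EFinP.
  by apply: measurable_funM => //; apply: measurable_funS mg0.
rewrite [RHS]ge0_integral_signed_half_square//; last first.
  apply: erestrict_ge0 => z /aly/=; rewrite in_itv/= andbT => z0.
  by rewrite lee_fin mulr_ge0 ?ghat_ge0// ltW.
apply: eq_integral => z _; rewrite !patchE.
rewrite !mem_setE/= !in_itv/= !andbT.
rewrite (_ : al ^+ 2 / 2 = signed_half_square al); last first.
  by rewrite /signed_half_square ger0_norm// expr2.
rewrite 2!ltNge signed_half_square_mono.
case: leP => [_|alz]/=; first by rewrite mul0e.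
rewrite -EFinM; congr (_%:E); rewrite /dens /signed_half_square.
by rewrite ger0_norm ?(le_trans al0 (ltW alz))// expr2 mulrC.
Qed.

(** This is [E[(Z - al)_+]] for [Z] of the standard law, kept in the extended reals because
    finiteness comes only with the closed form. *)
Definition partial_moment al := (\int[mu]_z (Num.max (z - al) 0 * w z)%:E)%E.

Let mposD al : measurable_fun [set: R] (fun z : R => Num.max (z - al) 0).
Proof. by apply: measurable_maxr => //; exact: measurable_funB. Qed.

(** On the tail split [z = (z - al) + al], both summands being nonnegative. The left side integrates
    to [Gbar], the last summand to [al * (1 - Phi al)]. *)
Lemma partial_moment_ge0E al : 0 <= al ->
  (partial_moment al = (Gbar k ghat (al ^+ 2 / 2) - al +
    al * Phi k ghat al)%:E)%E.
Proof.
move=> al0.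
have : (\int[mu]_(z in `]al, +oo[) (z * w z)%:E =
   partial_moment al + al%:E * \int[mu]_(z in `]al, +oo[) (w z)%:E)%E.
  rewrite -ge0_integralZl//; last 2 first.
    exact: measurable_funTS measurable_EFin_dens.
    by move=> z _; rewrite lee_fin dens_ge0.
  have -> : partial_moment al =
      (\int[mu]_(z in `]al, +oo[) (Num.max (z - al) 0 * w z)%:E)%E.
    rewrite /partial_moment [RHS]integral_mkcond; apply: eq_integral => z _.
    rewrite patchE mem_setE/= in_itv/= andbT; case: ltP => // zal.
    by rewrite max_r ?mul0r// subr_le0.
  rewrite -ge0_integralD//.
  - apply: eq_integral => z; rewrite mem_setE/= in_itv/= andbT => /ltW alz.
    by rewrite -EFinM -EFinD max_l ?subr_ge0// -mulrDl subrK.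
  - by move=> z _; rewrite lee_fin mulr_ge0 ?dens_ge0// le_max lexx orbT.
  - apply: measurable_funTS; exact: mdensM (mposD al).
  - by move=> z _; rewrite -EFinM lee_fin mulr_ge0 ?dens_ge0.
  - apply/measurable_EFinP/measurable_funTS/measurable_funM => //.
    exact: measurable_dens.
rewrite integral_id_dens_tail// integral_dens_tail.
case: (partial_moment al) => [r| |]//= [->].
by congr (_%:E); ring.
Qed.

(* Integrate (z + a)_+ + (-z)_+ = (-z - a)_+ + a + z_+ against the density,
   which is even. *)
Lemma partial_momentN a : 0 <= a ->
  (partial_moment (- a) = partial_moment a + a%:E)%E.
Proof.
move=> a0.
have partial_ge0 (f : R -> R) z : (0 <= (Num.max (f z) 0 * w z)%:E)%E.
  by rewrite lee_fin mulr_ge0 ?dens_ge0// le_max lexx orbT.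
have reflect b :
    partial_moment b = (\int[mu]_z (Num.max (- z - b) 0 * w z)%:E)%E.
  rewrite /partial_moment -ge0_integral_lebesgueN//; last 2 first.
  - exact: mdensM (mposD b).
  - by move=> z; exact: (partial_ge0 (fun z => z - b)).
  by apply: eq_integral => z _; rewrite densN.
have integralD_dens (f g : R -> R) :
    measurable_fun [set: R] f -> measurable_fun [set: R] g ->
    (forall z, 0 <= f z) -> (forall z, 0 <= g z) ->
    (\int[mu]_z (f z * w z)%:E + \int[mu]_z (g z * w z)%:E =
     \int[mu]_z ((f z + g z) * w z)%:E)%E.
  move=> mf mg f0 g0; rewrite -ge0_integralD//.
  - by apply: eq_integral => z _; rewrite -EFinD -mulrDl.
  - by move=> z _; rewrite lee_fin mulr_ge0 ?dens_ge0.
  - exact: mdensM mf.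
  - by move=> z _; rewrite lee_fin mulr_ge0 ?dens_ge0.
  - exact: mdensM mg.
have adensE : (\int[mu]_z (a * w z)%:E = a%:E)%E.
  under eq_integral do rewrite EFinM.
  rewrite ge0_integralZl//; first by rewrite integral_dens mule1.
  by move=> z _; rewrite lee_fin dens_ge0.
pose pos b (z : R) := Num.max (z - b) 0.
pose neg b (z : R) := Num.max (- z - b) 0.
have pos_ge0 b z : 0 <= pos b z by rewrite le_max lexx orbT.
have neg_ge0 b z : 0 <= neg b z by rewrite le_max lexx orbT.
have mneg b : measurable_fun [set: R] (neg b).
  by apply: measurable_maxr => //; exact: measurable_funB.
(* Adding [partial_moment 0] to both sides keeps all integrands nonnegative; its closed form shows
   that it is finite, so it cancels at the end. *)
have : (partial_moment (- a) + partial_moment 0 =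
        (partial_moment a + a%:E) + partial_moment 0)%E.
  transitivity (\int[mu]_z ((pos (- a) z + neg 0 z) * w z)%:E)%E.
    rewrite [partial_moment 0]reflect.
    exact: integralD_dens (mposD _) (mneg _) (pos_ge0 _) (neg_ge0 _).
  transitivity (\int[mu]_z (((neg a z + a) + pos 0 z) * w z)%:E)%E.
    apply: eq_integral => z _; congr (_ * _)%:E; rewrite /pos /neg /Num.max.
    by do 4 case: ifPn; lra.
  rewrite -(integralD_dens (neg a \+ cst a) (pos 0))//; last 3 first.
  - exact: measurable_funD.
  - exact: mposD.
  - by move=> z; rewrite /= addr_ge0.
  by rewrite -(integralD_dens (neg a) (cst a))// adensE -reflect.
rewrite (partial_moment_ge0E (lexx 0)) (partial_moment_ge0E a0).
by case: (partial_moment (- a)) => [r| |]//= [/addIr ->].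
Qed.

(** For negative [al], the closed form at [- al] plus the correction [- al] is the closed form at
    [al], by the symmetry [PhiN]. *)
Lemma partial_momentE al :
  (partial_moment al = (Gbar k ghat (al ^+ 2 / 2) - al +
    al * Phi k ghat al)%:E)%E.
Proof.
have [|/ltW al0] := leP 0 al; first exact: partial_moment_ge0E.
have na0 : 0 <= - al by rewrite oppr_ge0.
rewrite -{1}(opprK al) partial_momentN// partial_moment_ge0E//.
by rewrite PhiN sqrrN -EFinD; congr (_%:E); ring.
Qed.

Local Notation Phi := (Phi k ghat).

(** The identity, as a random variable under the law with density [w], has distribution function
    [Phi], which thus inherits monotonicity, limits and right continuity. *)
Let prob_mixin := Measure_isProbability.Build _ _ R
  (mdensity mu dens_ge0 measurable_dens) integral_dens.
Let prob : probability (measurableTypeR R) R :=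
  HB.pack (mdensity mu dens_ge0 measurable_dens) prob_mixin.
Let idRV_mixin := isMeasurableFun.Build _ _ (measurableTypeR R) R idfun
  (@measurable_id _ _ _).
Let idRV : {RV prob >-> R} :=
  HB.pack (idfun : measurableTypeR R -> R) idRV_mixin.

Let cdfE z : cdf idRV z = (Phi z)%:E.
Proof. exact: PhiE. Qed.

Lemma Phi_nondecreasing : {homo Phi : x y / x <= y}.
Proof. by move=> x y xy; rewrite -lee_fin -!cdfE cdf_nondecreasing. Qed.

Lemma Phi_le1 z : Phi z <= 1.
Proof. by rewrite -lee_fin -cdfE cdf_le1. Qed.

Let Phi_cvg (F : set_system R) (FF : Filter F) (l : R) :
  cdf idRV x @[x --> F] --> l%:E -> Phi x @[x --> F] --> l.
Proof.
move=> /fine_cvg; apply: cvg_trans; apply: near_eq_cvg; near=> x.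
by apply: esym; exact: (congr1 fine (cdfE x)).
Unshelve. all: by end_near. Qed.

Lemma cvg_PhiNy0 : Phi x @[x --> -oo] --> (0 : R).
Proof. exact: Phi_cvg (cvg_cdfNy0 idRV). Qed.

Lemma cvg_Phiy1 : Phi x @[x --> +oo] --> (1 : R).
Proof. exact: Phi_cvg (cvg_cdfy1 idRV). Qed.

Lemma Phi_right_continuous z : Phi x @[x --> z^'+] --> Phi z.
Proof. by apply: Phi_cvg; rewrite -cdfE; exact: cdf_right_continuous. Qed.

(** The infimum is a genuine lower bound: its set is bounded below because [Phi] tends to 0 at [-oo]
    and [p > 0]. *)
Lemma Phi_inv_gt p z : 0 < p -> z < Phi_inv k ghat p -> Phi z < p.
Proof.
move=> p0; apply: contraTT; rewrite -!leNgt => pz.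
apply: ge_inf => //.
have [M [_ PhiM]] := cvgr_lt _ cvg_PhiNy0 _ p0.
exists (M - 1) => y /= py; rewrite leNgt; apply/negP => yM.
have : Phi y < p by apply: PhiM; lra.
by rewrite ltNge py.
Qed.

(** If [Phi z < p], right continuity gives [y > z] with [Phi y < p], and this [y] bounds the
    defining set from below. That set is nonempty since [Phi] tends to 1 and [p < 1]. *)
Lemma Phi_inv_le p z : p < 1 -> Phi_inv k ghat p <= z -> p <= Phi z.
Proof.
move=> p1; apply: contraTT; rewrite -!ltNge => zp.
have [M [_ PhiM]] := cvgr_gt _ cvg_Phiy1 _ p1.
near z^'+ => y.
have zy : z < y by near: y; exact: nbhs_right_gt.
have yp : Phi y < p.
  by near: y; exact: cvgr_lt (@Phi_right_continuous z) _ zp.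
apply: (lt_le_trans zy); apply: lb_le_inf.
  by exists (M + 1) => /=; apply: ltW; apply: PhiM; lra.
move=> x /= px; rewrite leNgt; apply/negP => /ltW/Phi_nondecreasing.
lra.
Unshelve. all: by end_near. Qed.

Definition hinge_fun al := Gbar k ghat (al ^+ 2 / 2) - al + al * Phi al.

Lemma hinge_fun_ge0 al : 0 <= hinge_fun al.
Proof.
rewrite -lee_fin -partial_momentE//; apply: integral_ge0 => z _.
by rewrite lee_fin mulr_ge0 ?dens_ge0// le_max lexx orbT.
Qed.

(** Integrate the pointwise bound of [(z - al)_+] from below by [(z - be)_+] plus [be - al] on
    [z > be]. Monotonicity and strict decrease both follow from it. *)
Lemma hinge_fun_gap al be : al <= be ->
  hinge_fun be + (be - al) * (1 - Phi be) <= hinge_fun al.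
Proof.
move=> albe; rewrite -lee_fin EFinD EFinM -integral_dens_tail//.
rewrite -!partial_momentE//.
have mpos b := mdensM (mposD b).
have mtail : measurable_fun [set: R]
    ((fun z => (be - al)%:E * (w z)%:E)%E \_ `]be, +oo[).
  apply/(measurable_restrictT _ _).1 => //; apply: measurable_funTS.
  by apply: emeasurable_funM.
have pos_ge0 b z : (0 <= (Num.max (z - b) 0 * w z)%:E)%E.
  by rewrite lee_fin mulr_ge0 ?dens_ge0// le_max lexx orbT.
have tail_ge0 z :
    (0 <= ((fun z => (be - al)%:E * (w z)%:E)%E \_ `]be, +oo[) z)%E.
  by apply: erestrict_ge0 => x _; rewrite lee_fin mulr_ge0 ?dens_ge0 ?subr_ge0.
rewrite -ge0_integralZl//; last 3 first.
- exact: measurable_funTS measurable_EFin_dens.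
- by move=> z _; rewrite lee_fin dens_ge0.
- by rewrite lee_fin subr_ge0.
rewrite [X in (_ + X)%E]integral_mkcond -ge0_integralD//; last exact: mpos.
apply: ge0_le_integral => //.
- by move=> z _; rewrite adde_ge0.
- by apply: emeasurable_funD; [exact: mpos|exact: mtail].
- exact: mpos.
move=> z _; rewrite patchE mem_setE/= in_itv/= andbT.
case: ltP => bez /=.
  by rewrite -EFinM -EFinD lee_fin -mulrDl ler_wpM2r ?dens_ge0// !max_l; lra.
by rewrite adde0 lee_fin ler_wpM2r ?dens_ge0// /Num.max; do 2 case: ifPn; lra.
Qed.

Lemma hinge_fun_nonincreasing : {homo hinge_fun : x y /~ x <= y}.
Proof.
move=> x y yx; apply: le_trans (hinge_fun_gap yx); rewrite lerDl.
by rewrite mulr_ge0 ?subr_ge0 ?Phi_le1.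
Qed.

Lemma hinge_fun_lt p al be : 0 < p -> p < 1 ->
  al < Phi_inv k ghat p -> Phi_inv k ghat p <= be ->
  hinge_fun be < hinge_fun al.
Proof.
(* At the midpoint [c], still below the quantile, [1 - Phi c > 1 - p > 0], so the drop from [al] to
   [c] is strict; beyond [c] monotonicity suffices. *)
move=> p0 p1 alq qbe; pose c := (al + Phi_inv k ghat p) / 2.
have [alc cq] : al < c /\ c < Phi_inv k ghat p by rewrite /c; split; lra.
have := hinge_fun_nonincreasing (le_trans (ltW cq) qbe).
have := hinge_fun_gap (ltW alc).
have := Phi_inv_gt p0 cq; nra.
Qed.

End StandardElliptical.

(** * Reduction of the hinge loss and the chance constraint to the standard law *)

Section Standardization.
Context {d : measure_display} {T : measurableType d} {R : realType}.
Variables (P : probability T R) (m : nat) (xi : 'I_m -> {RV P >-> R}).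
Variables (mu : 'cV[R]_m) (S : 'M[R]_m) (k : R) (ghat : R -> R).
Hypotheses (S_posdef : posdef S) (ghat_std : std_elliptical k ghat).
Hypothesis xi_elliptical : elliptical xi mu S k ghat.

Lemma sdev_ge0 (a : 'cV[R]_m) : 0 <= sdev S a.
Proof. exact: sqrtr_ge0. Qed.

Lemma sdev_eq0 (a : 'cV[R]_m) : (sdev S a == 0) = (a == 0).
Proof.
have [->|a0] := eqVneq a 0.
  by rewrite /sdev /dotv mulmx0 mulmx0 mxE sqrtr0 eqxx.
by apply/negbTE; rewrite gt_eqF// sqrtr_gt0; case: S_posdef => _; exact.
Qed.

Lemma measurable_dotv_rvec (a : 'cV[R]_m) :
  measurable_fun [set: T] (fun t => dotv (rvec xi t) a).
Proof.
rewrite (_ : (fun t => _) = fun t => \sum_(i < m) xi i t * a i 0); last first.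
  apply/funext => t; rewrite /dotv mxE; apply: eq_bigr => i _.
  by rewrite !mxE.
by apply: measurable_sum => i; exact: measurable_funM.
Qed.

Definition standardized (a : 'cV[R]_m) (t : T) : R :=
  (dotv (rvec xi t) a - dotv mu a) / sdev S a.

Lemma measurable_standardized a : measurable_fun [set: T] (standardized a).
Proof.
apply: measurable_funM => //; apply: measurable_funB => //.
exact: measurable_dotv_rvec.
Qed.

(** By the marginal clause of [elliptical], the image of [P] under [standardized a] is the measure
    with density [dens]. *)
Lemma ge0_integral_standardized a (f : R -> \bar R) : a != 0 ->
  measurable_fun [set: R] f -> (forall z, 0 <= f z)%E ->
  (\int[P]_t f (standardized a t) =
   \int[lebesgue_measure]_z (f z * (dens k ghat z)%:E))%E.
Proof.
move=> a0 mf f0.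
have w0 := dens_ge0 ghat_std.
have mw := measurable_dens ghat_std.
rewrite -(ge0_integral_mdensity lebesgue_measure w0 mw)//.
transitivity (\int[pushforward P (standardized a : T -> measurableTypeR R)]_z
    f z)%E.
  by rewrite ge0_integral_pushforward//; exact: measurable_standardized.
apply: eq_measure_integral => [|mZ A mA _].
  exact: measurable_standardized.
exact: (xi_elliptical.2 a a0 A mA).
Qed.

Variables (n : nat) (a1 : 'cV[R]_n -> 'cV[R]_m) (b1 : 'cV[R]_n -> R).
Local Notation margin := (margin a1 b1 mu).
Local Notation s x := (sdev S (a1 x)).

(** The lower-level constraint determines [al] from [x], so the objective can be taken as a function
    of [x] alone. *)
Definition objective x :=
  lower_level_objective a1 b1 mu S k ghat (x, ratio (margin x) (s x)).

Lemma objective_sdev_neq0 x : s x != 0 ->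
  objective x = s x * hinge_fun k ghat (margin x / s x).
Proof. by move=> s0; rewrite /objective /ratio (negbTE s0). Qed.

(** The sign of the margin selects the branch [-oo], [+oo] or 0 of the ratio; together they give the
    hinge loss of the constant [- margin x]. *)
Lemma objective_sdev0 x : s x = 0 -> objective x = Num.max (- margin x) 0.
Proof.
move=> s0; rewrite /objective /ratio s0 eqxx.
have [M0|M0|->] := ltrgtP (margin x) 0.
- rewrite ltr0_sg// EFinN mulN1e/= max_l// oppr_ge0; exact: ltW.
- rewrite gtr0_sg// mul1e/= max_r// oppr_le0; exact: ltW.
- by rewrite sgr0 mul0e /lower_level_objective/= s0 mul0r oppr0 maxxx.
Qed.

Let hingeE t x : s x != 0 ->
  dotv (rvec xi t) (a1 x) - b1 x =
  s x * (standardized (a1 x) t - margin x / s x).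
Proof. by move=> s0; rewrite /standardized /Defs.margin; field. Qed.

(** Factor out [s x] and standardize; if [s x = 0], positive definiteness gives [a1 x = 0] and the
    loss is deterministic. This turns hinge-loss minimizers into lower-level solutions. *)
Lemma expected_hingeE x : expected_hinge xi a1 b1 x = (objective x)%:E.
Proof.
rewrite /expected_hinge unlock.
have [s0|s0] := eqVneq (s x) 0.
  rewrite objective_sdev0//.
  have a0 : a1 x = 0 by apply/eqP; rewrite -sdev_eq0; exact/eqP.
  under eq_integral do rewrite a0 /dotv mulmx0 mxE sub0r.
  rewrite integral_cst//= probability_setT mule1.
  by rewrite /Defs.margin a0 /dotv mulmx0 mxE subr0.
rewrite objective_sdev_neq0// EFinM -partial_momentE// /partial_moment.
set al := margin x / s x.
have mpos : measurable_fun [set: R] (fun z : R => (Num.max (z - al) 0)%:E).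
  apply/measurable_EFinP.
  by apply: measurable_maxr => //; exact: measurable_funB.
have pos_ge0 z : (0 <= (Num.max (z - al) 0)%:E)%E.
  by rewrite lee_fin le_max lexx orbT.
rewrite -(ge0_integral_standardized (a := a1 x) _ mpos)//; last first.
  by rewrite -sdev_eq0.
rewrite -ge0_integralZl//; last 2 first.
- exact: measurableT_comp mpos (measurable_standardized _).
- by rewrite lee_fin sdev_ge0.
apply: eq_integral => t _; rewrite -EFinM hingeE//.
by rewrite maxr_pMr ?sdev_ge0// mulr0.
Qed.

(** For [s x > 0] the probability is [Phi] at [margin x / s x], and the quantile lemmas invert
    [Phi]. For [s x = 0] the event has probability 0 or 1, decided by the sign of [b1 x]. *)
Lemma chance_constraintE eps x : 0 < eps -> eps < 1 ->
  chance_constraint xi a1 b1 eps x <->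
  quantile_constraint a1 b1 mu S k ghat eps x.
Proof.
move=> eps0 eps1; rewrite /chance_constraint /quantile_constraint.
have [s0|s0] := eqVneq (s x) 0.
  rewrite s0 mulr0.
  have a0 : a1 x = 0 by apply/eqP; rewrite -sdev_eq0; exact/eqP.
  rewrite /Defs.margin a0 /dotv.
  under eq_set do rewrite mulmx0 mxE.
  rewrite mulmx0 mxE subr0 sub0r oppr_le0.
  have [b0|b0] := leP 0 (b1 x).
    rewrite (_ : [set _ | true] = setT); last by apply/seteqP; split.
    rewrite probability_setT lee_fin; split => // _; lra.
  rewrite (_ : [set _ | false] = set0); last by apply/seteqP; split.
  rewrite measure0 lee_fin; split => //; lra.
have s_gt0 : 0 < s x by rewrite lt_neqAle eq_sym s0 sdev_ge0.
have -> : [set t | dotv (rvec xi t) (a1 x) - b1 x <= 0] =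
    [set t | `]-oo, margin x / s x]%classic (standardized (a1 x) t)].
  apply/seteqP; split => t /=; rewrite in_itv/= hingeE//.
    by rewrite pmulr_rle0// subr_le0.
  by rewrite pmulr_rle0// subr_le0.
rewrite (xi_elliptical.2 (a1 x))//; last by rewrite -sdev_eq0.
rewrite PhiE// lee_fin -ler_pdivlMr//; split => [Phi_ge|qM].
  rewrite leNgt; apply/negP => Mq.
  have : Phi k ghat (margin x / s x) < 1 - eps.
    by apply: (Phi_inv_gt ghat_std) => //; lra.
  by rewrite ltNge Phi_ge.
by apply: (Phi_inv_le ghat_std) => //; lra.
Qed.

Lemma quantile_constraint_const_sdev eps (C : R) x y : 0 < eps -> eps < 1 ->
  0 < C -> s x = C -> s y = C -> objective x <= objective y ->
  quantile_constraint a1 b1 mu S k ghat eps y ->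
  quantile_constraint a1 b1 mu S k ghat eps x.
Proof.
move=> eps0 eps1 C0 sx sy; rewrite /quantile_constraint sx sy.
rewrite !objective_sdev_neq0 ?sx ?sy ?gt_eqF// ler_pM2l//.
rewrite -!ler_pdivlMr// => hxy qy; rewrite leNgt; apply/negP => xq.
suff : hinge_fun k ghat (margin y / C) < hinge_fun k ghat (margin x / C).
  by rewrite ltNge hxy.
by apply: (hinge_fun_lt ghat_std (p := 1 - eps)) => //; lra.
Qed.

(** Either sign alternative forces [C >= 0] once [y] is feasible. For [C < 0] and [q < 0] the
    constraint would bound [s] from below, while the hinge loss is nondecreasing in [s]. *)
Lemma quantile_constraint_const_margin eps (C : R) x y : 0 < eps -> eps < 1 ->
  0 <= C \/ 0 <= Phi_inv k ghat (1 - eps) ->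
  margin x = C -> margin y = C -> objective x <= objective y ->
  quantile_constraint a1 b1 mu S k ghat eps y ->
  quantile_constraint a1 b1 mu S k ghat eps x.
Proof.
move=> eps0 eps1; rewrite /quantile_constraint.
set q := Phi_inv _ _ _ => Cq Mx My + qy; apply: contraTT.
rewrite -!ltNge => xq.
have sx0 := sdev_ge0 (a1 x); have sy0 := sdev_ge0 (a1 y).
have C0 : 0 <= C.
  by case: Cq => // q0; rewrite -My (le_trans _ qy)// mulr_ge0.
rewrite Mx in xq; rewrite My in qy.
have sx_gt0 : 0 < s x.
  by rewrite lt_neqAle sx0 andbT; apply/eqP => sx; move: xq; rewrite -sx; lra.
have q_gt0 : 0 < q by nra.
have hlt be : q <= be -> hinge_fun k ghat be < hinge_fun k ghat (C / s x).
  move=> qbe; apply: (hinge_fun_lt ghat_std (p := 1 - eps)) => //.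
  - by lra.
  - by lra.
  - by rewrite ltr_pdivrMr.
have h0 := hinge_fun_ge0 ghat_std.
rewrite [objective x]objective_sdev_neq0 ?gt_eqF// Mx.
(* If [s y = 0], the objective at [y] is 0 because [C >= 0], while at [x] it is positive:
   [hinge_fun] at [C / s x] strictly exceeds its nonnegative value at [q]. *)
have [sy|sy] := eqVneq (s y) 0.
  rewrite objective_sdev0// My max_r ?oppr_le0// mulr_gt0//.
  by apply: le_lt_trans (hlt q _).
have sy_gt0 : 0 < s y by rewrite lt_neqAle eq_sym sy.
rewrite objective_sdev_neq0// My.
have h1 : hinge_fun k ghat (C / s y) < hinge_fun k ghat (C / s x).
  by apply: hlt; rewrite ler_pdivlMr.
have h2 := h0 (C / s y).
(* Here [q * s y <= C < q * s x] with [q > 0]. *)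
have h3 : s y < s x by rewrite -(ltr_pM2l q_gt0) (le_lt_trans qy).
by rewrite ltr_pM// ltW.
Qed.

End Standardization.

(** * Optimality of ALSO-X under constant deviation or constant margin *)

Theorem theorem4 (d : measure_display) (T : measurableType d) (R : realType)
  (P : probability T R) (n m : nat)
  (c : 'cV[R]_n) (X : set 'cV[R]_n)
  (a1 : 'cV[R]_n -> 'cV[R]_m) (b1 : 'cV[R]_n -> R)
  (xi : 'I_m -> {RV P >-> R})
  (mu : 'cV[R]_m) (Sigma : 'M[R]_m) (k : R) (ghat : R -> R)
  (eps vstar : R)
  (X_nonempty : X !=set0) (X_closed : closed X)
  (a1_affine : is_affine_vec a1) (b1_affine : is_affine_fun b1)
  (Sigma_posdef : posdef Sigma)
  (ghat_std : std_elliptical k ghat)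
  (xi_elliptical : elliptical xi mu Sigma k ghat)
  (eps_gt0 : 0 < eps) (eps_lt1 : eps < 1)
  (hinge_attained : forall t : R, level_set c X t !=set0 ->
     exists x, minimizes (level_set c X t) (expected_hinge xi a1 b1) x)
  (vstar_opt : is_minimum
     [set dotv c x | x in
        X `&` [set x | quantile_constraint a1 b1 mu Sigma k ghat eps x]] vstar)
  (special :
     (exists C : R, 0 < C /\ X `<=` [set x | sdev Sigma (a1 x) = C]) \/
     (exists C : R, X `<=` [set x | margin a1 b1 mu x = C] /\
        (0 <= C \/ 0 <= Phi_inv k ghat (1 - eps)))) :
  is_minimum (alsox_feasible c X a1 b1 mu Sigma k ghat eps) vstar /\
  forall x al, lower_level_solution c X a1 b1 mu Sigma k ghat vstar x al ->
    minimizes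
      (X `&` [set x | quantile_constraint a1 b1 mu Sigma k ghat eps x])
      (dotv c) x /\
    minimizes (X `&` [set x | chance_constraint xi a1 b1 eps x]) (dotv c) x.
Proof.
have [[xs [Xxs qxs] cxs] vstar_le] := vstar_opt.
have quantile_of_le x y : X x -> X y ->
    objective mu Sigma k ghat a1 b1 x <= objective mu Sigma k ghat a1 b1 y ->
    quantile_constraint a1 b1 mu Sigma k ghat eps y ->
    quantile_constraint a1 b1 mu Sigma k ghat eps x.
  move=> Xx Xy; case: special => [[C [C0 XC]]|[C [XC Cq]]].
    exact: quantile_constraint_const_sdev eps_gt0 eps_lt1 C0
      (XC _ Xx) (XC _ Xy).
  exact: quantile_constraint_const_margin eps_gt0 eps_lt1 Cq
    (XC _ Xx) (XC _ Xy).
have solution_quantile x al :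
    lower_level_solution c X a1 b1 mu Sigma k ghat vstar x al ->
    [/\ X x, dotv c x <= vstar &
      quantile_constraint a1 b1 mu Sigma k ghat eps x].
  move=> [[[Xx cx] /= <-] x_min]; split=> //.
  (* The optimal [xs] has cost exactly [vstar], so it competes in the lower level at [vstar], and
     its feasibility passes to the minimizer [x]. *)
  apply: (quantile_of_le x xs) => //.
  by apply: (x_min (xs, _)); split => //; split => //=; rewrite cxs.
have lower x : X x -> quantile_constraint a1 b1 mu Sigma k ghat eps x ->
    vstar <= dotv c x.
  by move=> Xx qx; apply: vstar_le; exists x.
split.
  split; last first.
    move=> t [x [al [[[[Xx cxt] _] _] qx]]].
    exact: le_trans (lower x Xx qx) cxt.
  (* Feasibility of [vstar] needs a lower-level solution to exist: a hinge-loss minimizer, paired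
     with its ratio, is one. *)
  have [|x [[Xx cx] x_min]] := hinge_attained vstar.
    by exists xs; split => //; rewrite cxs.
  have sol : lower_level_solution c X a1 b1 mu Sigma k ghat vstar x
      (ratio (margin a1 b1 mu x) (sdev Sigma (a1 x))).
    split => // -[y al] [/= Ly <-].
    have := x_min y Ly.
    by rewrite !(expected_hingeE Sigma_posdef ghat_std xi_elliptical) lee_fin.
  exists x; eexists; split; first exact: sol.
  by case: (solution_quantile _ _ sol).
move=> x al /solution_quantile[Xx cx qx].
have chanceE y := chance_constraintE Sigma_posdef ghat_std xi_elliptical
  a1 b1 y eps_gt0 eps_lt1.
split; split => //.
- by move=> y [Xy qy]; exact: le_trans cx (lower y Xy qy).
- by split => //=; apply/chanceE.
- by move=> y [Xy /chanceE qy]; exact: le_trans cx (lower y Xy qy).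
Qed.
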